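(* Let $t>0$. For every angle $\theta$ such that the ray from the origin with angle $\theta$ intersects $\Sigma_t$, the function $w_t$ may be computed as $$w_t(\theta)=\frac{1}{2\pi t}\,\omega(r_t(\theta),\theta),$$ where $$\omega(r,\theta)=1+h(r)\,\frac{\alpha(r)\cos\theta+\beta(r)}{\beta(r)\cos\theta+\alpha(r)},$$ with $$h(r)=r\,\frac{\log(r^2)}{r^2-1};\qquad \alpha(r)=r^2+1-2r\,h(r);\qquad \beta(r)=(r^2+1)h(r)-2r.$$
   Context: Let $f_t(\lambda)=\lambda e^{\frac t2\frac{1+\lambda}{1-\lambda}}$ on $\mathbb C\setminus\{1\}$, $F_t=\{\lambda\in\mathbb C:\ |\lambda|\ne1,\ |f_t(\lambda)|=1\}$, $E_t=\overline{F_t}$, and let $\Sigma_t$ be the connected component of $\mathbb C\setminus E_t$ containing $1$. If the ray from the origin with angle $\theta$ meets $\Sigma_t$ (which happens for all $\theta$ if $t>4$, and for $|\theta|<\cos^{-1}(1-t/2)$, $\theta\in(-\pi,\pi]$, if $t\le4$), it does so in an interval $1/r_t(\theta)<r<r_t(\theta)$ with $r_t(\theta)>1$; thus $r_t(\theta)$ is the larger of the two radii where the ray meets $\partial\Sigma_t$. The function $w_t$ is the function giving the density $\frac1{r^2}w_t(\theta)$ on $\Sigma_t$ of the Brown measure of the free multiplicative Brownian motion $b_t$, namely $$w_t(\theta)=\frac{1}{4\pi}\left(\frac{2}{t}+\frac{\partial}{\partial\theta}\,\frac{2r_t(\theta)\sin\theta}{r_t(\theta)^2+1-2r_t(\theta)\cos\theta}\right).$$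 *)

(* Defs.v *)
From mathcomp Require Export all_boot all_order all_algebra.
From mathcomp Require Export all_classical all_reals all_analysis.
From mathcomp.real_closed Require Export complex.

Set Implicit Arguments.
Unset Strict Implicit.
Unset Printing Implicit Defensive.

Export Order.TTheory GRing.Theory Num.Theory.
Export numFieldNormedType.Exports.

Local Open Scope classical_set_scope.
Local Open Scope ring_scope.
Local Open Scope complex_scope.

(* The complex plane is R[i]^o: the regular-algebra alias carries the
   topology given by the modulus. *)

Definition cexp (R : realType) (z : R[i]) : R[i] :=
  (expR (complex.Re z))%:C * (cos (complex.Im z) +i* sin (complex.Im z)).

(* Only meaningful for z != 1. *)
Definition f (R : realType) (t : R) (z : R[i]) : R[i] :=
  z * cexp ((t / 2)%:C * ((1 + z) / (1 - z))).

(* The excluded point 1 of the domain of [f t] has modulus 1, hence is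
   ruled out by the first condition. *)
Definition F (R : realType) (t : R) : set (R[i]^o) :=
  [set z : R[i]^o | `|z| != 1 /\ `|f t z| = 1].

Definition E (R : realType) (t : R) : set (R[i]^o) := closure (F t).

Definition Sigma (R : realType) (t : R) : set (R[i]^o) :=
  connected_component (~` E t) (1 : R[i]^o).

Definition frontier (T : topologicalType) (A : set T) : set T :=
  closure A `\` interior A.

Definition polar (R : realType) (r theta : R) : R[i]^o :=
  r%:C * (cos theta +i* sin theta).

Definition ray_meets_Sigma (R : realType) (t theta : R) : Prop :=
  exists2 r : R, 0 <= r & Sigma t (polar r theta).

(* The larger of the two radii at which the ray of angle theta meets the
   frontier of [Sigma t]. It is only meaningful if the ray meets [Sigma t];
   otherwise [sup] may return its default value 0. *)
Definition r_ (R : realType) (t theta : R) : R :=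
  sup [set r : R | 0 <= r /\ frontier (Sigma t) (polar r theta)].

Definition w_arg (R : realType) (t theta : R) : R :=
  2 * r_ t theta * sin theta /
  ((r_ t theta) ^+ 2 + 1 - 2 * r_ t theta * cos theta).

Definition w (R : realType) (t theta : R) : R :=
  (4 * pi)^-1 * (2 / t + (w_arg t)^`()%classic theta).

Definition h (R : realType) (r : R) : R := r * (ln (r ^+ 2) / (r ^+ 2 - 1)).

Definition alpha (R : realType) (r : R) : R := r ^+ 2 + 1 - 2 * r * h r.

Definition beta (R : realType) (r : R) : R := (r ^+ 2 + 1) * h r - 2 * r.

Definition omega (R : realType) (r theta : R) : R :=
  1 + h r * ((alpha r * cos theta + beta r) / (beta r * cos theta + alpha r)).

(* Main.v *)
From mathcomp Require Import ring lra.
Require Import Defs.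

(** On a point of modulus [r] and angle [theta], [|f_t| = 1] off the unit circle
amounts to [T = t] with [T = |z - 1|^2 log(r^2) / (r^2 - 1)]. Along each ray, [T]
is invariant under [r -> 1/r] and strictly increasing on [r >= 1], and it is
strictly decreasing in [cos theta]; hence [Sigma_t] is [{T < t}] and [r_t(theta)]
is the only [r > 1] with [T = t]. This equation is
[(r + 1/r - 2 cos theta) h(r) = t], so that the function differentiated in [w_t]
is [(2 / t) sin theta h(r_t(theta))], and
[cos theta = (r + 1/r) / 2 - (t / 2) / h(r)] at [r = r_t(theta)]. The right-hand
side has derivative [(alpha + beta cos theta) / (r h(r) (r^2 - 1)) > 0] in [r], which
yields [r_t'(theta)] by implicit differentiation; the formula follows with
[h'(r) = - beta / (r (r^2 - 1))]. *)

Set Implicit Arguments.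
Unset Strict Implicit.
Unset Printing Implicit Defensive.

Local Open Scope ring_scope.

(** * Logarithm inequalities and the logarithmic mean *)

Section LogMean.
Local Open Scope classical_set_scope.
Local Open Scope ring_scope.
Variable R : realType.
Implicit Types c q r s t u v : R.

(** Mean value theorem. Positivity is asked only to the right of [a], because both derivatives to
    which this is applied vanish at [a = 1]. *)
Lemma gt0_derive_gt (g dg : R -> R) (a : R) :
  (forall x : R, a <= x -> is_derive x 1 g (dg x)) ->
  (forall x, a < x -> 0 < dg x) -> forall x, a < x -> g a < g x.
Proof.
move=> gD dg_gt0 x ax.
have [c] : exists2 c, c \in `]a, x[%R & g x - g a = dg c * (x - a).
  apply: MVT => // [y|]; first by rewrite in_itv/= => /andP[/ltW/gD].
  apply: derivable_within_continuous => y; rewrite in_itv/= => /andP[/gD yD _].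
  exact: ex_derive.
rewrite in_itv/= => /andP[ac _] E.
by rewrite -subr_gt0 E mulr_gt0 ?dg_gt0 ?subr_gt0.
Qed.

Lemma is_derive_inv (x : R) : x != 0 -> is_derive x 1 GRing.inv (- x ^- 2).
Proof.
move=> x0; have := is_deriveV x0 (is_derive_id x (1 : R)).
by rewrite /GRing.scale/= mulr1.
Qed.

(** The left side is [2 - 4 / (q + 1)], and the difference of the two sides has derivative
    [(x - 1)^2 / (x (x + 1)^2)]. *)
Lemma ln_gt_pade q : 1 < q -> 2 * (q - 1) / (q + 1) < ln q.
Proof.
move=> q1.
pose g x : R := ln x - 2 + 4 * (x + 1)^-1.
pose dg x : R := (x - 1) ^+ 2 / (x * (x + 1) ^+ 2).
suff: g 1 < g q.
  rewrite /g ln1 => H; rewrite -subr_gt0.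
  have -> : ln q - 2 * (q - 1) / (q + 1) = ln q - 2 + 4 * (q + 1)^-1.
    by field; lra.
  by move: H; have -> : 0 - 2 + 4 * (1 + 1)^-1 = 0 :> R by field.
apply: (@gt0_derive_gt _ dg) => // [x x1|x x1]; last first.
  have x10 : 0 < x - 1 by lra.
  have x0 : 0 < x by lra.
  have x2 : 0 < x + 1 by lra.
  by rewrite /dg divr_gt0 ?mulr_gt0 ?exprn_gt0.
have x0 : 0 < x by lra.
have x10 : x + 1 != 0 by lra.
have := is_derive1_ln x0 => H.
apply: is_derive_eq; rewrite /dg.
rewrite /GRing.scale/=; field; lra.
Qed.

(** This is [L < sinh L] for [L = ln q]; the difference has the square [(1 - 1/x)^2] as
    derivative. *)
Lemma ln_lt_sinh q : 1 < q -> 2 * ln q < q - q^-1.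
Proof.
move=> q1.
pose g x : R := x - x^-1 - 2 * ln x.
pose dg x : R := (1 - x^-1) ^+ 2.
suff: g 1 < g q by rewrite /g ln1 invr1; lra.
apply: (@gt0_derive_gt _ dg) => // [x x1|x x1]; last first.
  by rewrite /dg exprn_gt0// subr_gt0 invf_lt1// (lt_trans ltr01).
have x0 : 0 < x by lra.
have x00 : x != 0 by lra.
have H := is_derive1_ln x0.
have HV := is_derive_inv x00.
apply: is_derive_eq; rewrite /dg.
rewrite /GRing.scale/=; field; lra.
Qed.


Lemma ln_le_subr1 s : 0 < s -> ln s <= s - 1.
Proof.
move=> s0; have := @le_ln1Dx R (s - 1).
by rewrite [1 + _]addrC subrK; apply; lra.
Qed.

Lemma ln_ge_1subrV s : 0 < s -> 1 - s^-1 <= ln s.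
Proof.
move=> s0; have : ln s^-1 <= s^-1 - 1 by apply: ln_le_subr1; rewrite invr_gt0.
by rewrite lnV ?posrE//; lra.
Qed.

(* Logarithmic mean of [s] and 1. At [s <= 0] the total [ln] and the junk inverse
   of 0 give 0, the value that makes it continuous on the whole line. *)
Definition logmean s : R := if s == 1 then 1 else (s - 1) / ln s.

Lemma logmean1 : logmean 1 = 1. Proof. by rewrite /logmean eqxx. Qed.

Lemma logmean_le0 s : s <= 0 -> logmean s = 0.
Proof.
move=> s0; rewrite /logmean ifF; last by apply/eqP => s1; move: s0; rewrite s1; lra.
by rewrite ln0// invr0 mulr0.
Qed.

Lemma logmean_gt0 s : 0 < s -> 0 < logmean s.
Proof.
move=> s0; rewrite /logmean; case: (ltgtP s 1) => //= s1.
  by rewrite nmulr_lgt0 ?subr_lt0// invr_lt0 ln_lt0// s0 s1.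
by rewrite divr_gt0// ?subr_gt0// ln_gt0.
Qed.

Lemma logmeanV s : 0 < s -> logmean s^-1 = logmean s / s.
Proof.
move=> s0; rewrite /logmean invr_eq1.
have [->|s1] := eqVneq; first by rewrite invr1 mulr1.
have l0 : ln s != 0 by rewrite ln_eq0.
by rewrite lnV ?posrE//; field; rewrite l0 lt0r_neq0.
Qed.

(** The mean lies between [s] and 1, by [1 - 1/s <= ln s <= s - 1]. This gives continuity at 1. *)
Lemma logmean_sub1 s : 0 < s -> `|logmean s - 1| <= `|s - 1|.
Proof.
move=> s0; have up := ln_le_subr1 s0; have dn := ln_ge_1subrV s0.
rewrite /logmean; case: (ltgtP s 1) => [s1|s1|->] /=; last by rewrite !subrr.
  have l0 : ln s < 0 by rewrite ln_lt0// s0 s1.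
  have E1 : (s - 1) / ln s <= 1 by rewrite ler_ndivrMr// mul1r.
  have E2 : s <= (s - 1) / ln s.
    rewrite ler_ndivlMr//; have -> : s - 1 = s * (1 - s^-1) by field; apply: lt0r_neq0.
    by rewrite ler_pM2l.
  by rewrite !ler0_norm; lra.
have l0 : 0 < ln s by rewrite ln_gt0.
have E1 : 1 <= (s - 1) / ln s by rewrite ler_pdivlMr// mul1r.
have E2 : (s - 1) / ln s <= s.
  rewrite ler_pdivrMr//; have -> : s - 1 = s * (1 - s^-1) by field; apply: lt0r_neq0.
  by rewrite ler_pM2l.
by rewrite !ger0_norm; lra.
Qed.

Lemma cvg_logmean s : logmean x @[x --> s] --> logmean s.
Proof.
have [s0|s0|s0] := ltgtP s 0.
- apply/cvgrPdist_lt => e e0; near=> x.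
  have x0 : x <= 0 by apply: ltW; near: x; exact: lt_nbhsl.
  by rewrite !logmean_le0 ?subrr ?normr0// ltW.
- have [s1|s1] := eqVneq s 1.
    apply/cvgrPdist_lt => e e0; near=> x.
    have x0 : 0 < x by near: x; exact: lt_nbhsr.
    rewrite s1 logmean1 distrC (le_lt_trans (logmean_sub1 x0))// distrC -s1.
    by near: x; apply: (@cvgr_dist_lt _ R _ _ _ id).
  have E : {near s, (fun x => (x - 1) / ln x) =1 logmean}.
    near=> x; rewrite /logmean ifN//.
    by near: x; apply: open_nbhs_nbhs; split; [exact: open_neq|].
  apply: cvg_trans (near_eq_cvg E) _.
  rewrite /logmean ifN//; apply: cvgM; first by apply: cvgB; [exact: cvg_id|exact: cvg_cst].
  by apply: cvgV; [rewrite ln_eq0|exact: continuous_ln].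
- rewrite s0 logmean_le0//; apply/cvgrPdist_lt => e e0; near=> x.
  rewrite sub0r normrN; have [x0|x0] := leP x 0.
    by rewrite logmean_le0// normr0.
  have x1 : x < 1 by near: x; exact: lt_nbhsl.
  have l0 : ln x < 0 by rewrite ln_lt0// x0 x1.
  (* On []0, 1[] the mean is [(1 - x) / (- ln x) < 1 / (- ln x)], so this bound brings it below
     [e]. *)
  have xe : ln x < - e^-1.
    rewrite -[X in _ < X]expRK ltr_ln ?posrE ?expR_gt0//.
    by near: x; apply: lt_nbhsl; exact: expR_gt0.
  rewrite gtr0_norm ?logmean_gt0// /logmean ifN ?lt_eqF//.
  rewrite ltr_ndivrMr//.
  have : e * ln x < -1 by rewrite -ltr_pdivlMl// mulrN1.
  lra.
Unshelve. all: by end_near. Qed.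

End LogMean.

(** * Monotonicity and level points of [radial] along a ray *)

Section Radial.
Local Open Scope classical_set_scope.
Local Open Scope ring_scope.
Variable R : realType.
Implicit Types c q r s t u v : R.

(* [radial] is the function [T] of the header; [gap] has the sign of [T - t] but is
   also continuous at the origin. *)
Definition radial c r : R := (r ^+ 2 + 1 - 2 * r * c) / logmean (r ^+ 2).

Definition gap t c r : R := r ^+ 2 + 1 - 2 * r * c - t * logmean (r ^+ 2).

(* With [L = ln r], these are [L coth(L / 2)] and [L tanh(L / 2)]. *)
Definition xcoth r : R := (r + 1) / (r - 1) * ln r.

Definition xtanh r : R := (r - 1) / (r + 1) * ln r.

Lemma ln_sqr r : 0 < r -> ln (r ^+ 2) = 2 * ln r.
Proof. by move=> r0; rewrite lnXn// mulr_natl. Qed.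

(** The numerator of [radial] is [(1 - c) (r + 1)^2 / 2 + (1 + c) (r - 1)^2 / 2]. For [-1 <= c <= 1]
    the weights are nonnegative, so monotonicity reduces to that of [xcoth] and [xtanh]. *)
Lemma radialE c r : 1 < r -> radial c r = (1 - c) * xcoth r + (1 + c) * xtanh r.
Proof.
move=> r1; have l0 := ln_gt0 r1.
have r20 : r ^+ 2 != 1 by rewrite gt_eqF// expr_gt1//; lra.
have [rp rm] : r + 1 != 0 /\ r - 1 != 0 by split; apply: lt0r_neq0; lra.
rewrite /radial /xcoth /xtanh /logmean (negbTE r20) ln_sqr; last lra.
field.
have : r ^+ 2 - 1 != 0 by rewrite subr_eq0.
by rewrite rp rm (lt0r_neq0 l0) expr2 => ->.
Qed.

Lemma xtanh_lt u v : 1 <= u -> u < v -> xtanh u < xtanh v.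
Proof.
move=> u1 uv; rewrite /xtanh.
have l1 : 0 <= ln u by apply: ln_ge0.
have l2 : ln u < ln v by rewrite ltr_ln ?posrE//; lra.
have E : (u - 1) / (u + 1) < (v - 1) / (v + 1).
  by rewrite ltr_pdivrMr; [rewrite mulrAC ltr_pdivlMr; nra|lra].
by apply: ltr_pM => //; rewrite divr_ge0//; lra.
Qed.

Lemma xcoth_gt2 v : 1 < v -> 2 < xcoth v.
Proof.
move=> v1; rewrite /xcoth mulrAC ltr_pdivlMr ?subr_gt0//.
by have := ln_gt_pade v1; rewrite ltr_pdivrMr; [lra|lra].
Qed.

(** The factor [(r + 1) / (r - 1)] decreases, so the factors cannot be compared one by one. With
    [v = u q], clearing denominators leaves [2 u (q - 1) ln u < (u q + 1) (u - 1) ln q]; then [ln u]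
    is bounded above by [ln_lt_sinh] and [ln q] below by [ln_gt_pade]. *)
Lemma xcoth_lt u v : 1 < u -> u < v -> xcoth u < xcoth v.
Proof.
move=> u1 uv; pose q := v / u.
have u0 : 0 < u by lra.
have q1 : 1 < q by rewrite ltr_pdivlMr// mul1r.
have vE : v = u * q by rewrite /q mulrC divfK// lt0r_neq0.
have Lq := ln_gt_pade q1; have Lu := ln_lt_sinh u1.
rewrite /xcoth vE lnM ?posrE//; last lra.
move: (ln q) (ln u) Lq Lu => a b Lq Lu.
have {}Lq : 2 * (q - 1) < a * (q + 1) by rewrite -ltr_pdivrMr//; lra.
have {}Lu : 2 * b * u < u ^+ 2 - 1.
  have -> : u ^+ 2 - 1 = (u - u^-1) * u by field; apply: lt0r_neq0.
  by rewrite ltr_pM2r.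
have uq1 : 1 < u * q by rewrite -vE; lra.
(* The two estimates leave the factor [2 (u q + 1) / ((q + 1) (u + 1))], which is
   at least 1 because [(u - 1) (q - 1) >= 0]. *)
have K : 2 * u * (q - 1) * b < (u * q + 1) * (u - 1) * a.
  apply: (@lt_trans _ _ ((q - 1) * (u ^+ 2 - 1))).
    have -> : 2 * u * (q - 1) * b = (q - 1) * (2 * b * u) by ring.
    by rewrite ltr_pM2l//; lra.
  rewrite -(@ltr_pM2r _ (q + 1)); last lra.
  apply: (@le_lt_trans _ _ ((u * q + 1) * (u - 1) * (2 * (q - 1)))).
    rewrite -subr_ge0.
    have -> : (u * q + 1) * (u - 1) * (2 * (q - 1)) -
      (q - 1) * (u ^+ 2 - 1) * (q + 1) = (u - 1) ^+ 2 * (q - 1) ^+ 2 by ring.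
    by rewrite mulr_ge0 ?sqr_ge0.
  by rewrite -[ltRHS]mulrA ltr_pM2l// mulr_gt0//; lra.
have [u1' v1'] : 0 < u - 1 /\ 0 < u * q - 1 by lra.
rewrite -subr_gt0.
have -> : (u * q + 1) / (u * q - 1) * (b + a) - (u + 1) / (u - 1) * b =
    ((u * q + 1) * (u - 1) * a - 2 * u * (q - 1) * b) / ((u - 1) * (u * q - 1)).
  by field; rewrite !lt0r_neq0.
by rewrite divr_gt0 ?subr_gt0// mulr_gt0.
Qed.

Lemma radial1 c : radial c 1 = 2 - 2 * c.
Proof. by rewrite /radial expr1n logmean1 divr1; ring. Qed.

(** The weights sum to 2; the sign of [c] selects one that is positive, and it carries the
    strictness. *)
Lemma wavg_lt c (a b a' b' : R) : -1 <= c <= 1 -> a < a' -> b < b' ->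
  (1 - c) * a + (1 + c) * b < (1 - c) * a' + (1 + c) * b'.
Proof.
move=> /andP[c1 c2] aa bb; have [c0|c0] := leP c 0.
  apply: ltr_leD; first by rewrite ltr_pM2l//; lra.
  by apply: ler_wpM2l; [lra|exact: ltW].
apply: ler_ltD; first by apply: ler_wpM2l; [lra|exact: ltW].
by rewrite ltr_pM2l//; lra.
Qed.

Lemma radial_lt c u v : -1 <= c <= 1 -> 1 <= u -> u < v ->
  radial c u < radial c v.
Proof.
move=> c11; rewrite le_eqVlt => /predU1P[<- v1|u1 uv].
  (* At 1 the limits 2 of [xcoth] and 0 of [xtanh] replace their values. *)
  have -> : radial c 1 = (1 - c) * 2 + (1 + c) * 0 by rewrite radial1; ring.
  rewrite radialE//; apply: wavg_lt => //; first exact: xcoth_gt2.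
  by have := xtanh_lt (lexx 1) v1; rewrite {1}/xtanh ln1 mulr0.
rewrite !radialE//; last lra.
by apply: wavg_lt => //; [exact: xcoth_lt|exact: xtanh_lt (ltW u1) uv].
Qed.

Lemma radial_le c u v : -1 <= c <= 1 -> 1 <= u -> u <= v ->
  radial c u <= radial c v.
Proof.
by move=> c1 u1; rewrite le_eqVlt => /predU1P[->//|uv]; rewrite ltW// radial_lt.
Qed.

(** Inversion divides both the numerator and [logmean (r ^+ 2)] by [r^2]. *)
Lemma radialV c r : 0 < r -> radial c r^-1 = radial c r.
Proof.
move=> r0; rewrite /radial exprVn logmeanV ?exprn_gt0//.
field; rewrite !lt0r_neq0// logmean_gt0// exprn_gt0//.
Qed.

Lemma radial_cos_lt r c c' : 0 < r -> c < c' -> radial c' r < radial c r.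
Proof.
move=> r0 cc; rewrite /radial ltr_pM2r; last by rewrite invr_gt0 logmean_gt0// exprn_gt0.
nra.
Qed.

Lemma gap0 t c : gap t c 0 = 1.
Proof. by rewrite /gap expr0n/= logmean_le0// !(mul0r, mulr0); ring. Qed.

Lemma gapE t c r : 0 < r -> gap t c r = (radial c r - t) * logmean (r ^+ 2).
Proof.
move=> r0; rewrite /gap /radial; field.
by rewrite lt0r_neq0// logmean_gt0// exprn_gt0.
Qed.

Lemma gap_lt0 t c r : 0 < r -> (gap t c r < 0) = (radial c r < t).
Proof. by move=> r0; rewrite gapE// pmulr_llt0 ?subr_lt0// logmean_gt0// exprn_gt0. Qed.

Lemma gap_gt0 t c r : 0 < r -> (0 < gap t c r) = (t < radial c r).
Proof. by move=> r0; rewrite gapE// pmulr_lgt0 ?subr_gt0// logmean_gt0// exprn_gt0. Qed.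

Lemma gap_eq0 t c r : 0 < r -> (gap t c r == 0) = (radial c r == t).
Proof. by move=> r0; rewrite !eq_le !leNgt gap_lt0// gap_gt0. Qed.

Lemma cvg_gap t c r : gap t c x @[x --> r] --> gap t c r.
Proof.
have id2 : (x : R) ^+ 2 @[x --> r] --> r ^+ 2.
  exact: exprn_continuous.
apply: cvgB.
  apply: cvgB; first by apply: cvgD; [exact: id2|exact: cvg_cst].
  by apply: cvgM; [apply: cvgM; [exact: cvg_cst|exact: cvg_id]|exact: cvg_cst].
apply: cvgM; first exact: cvg_cst.
exact: (cvg_comp _ _ id2 (@cvg_logmean R (r ^+ 2))).
Qed.

Lemma radial_unbounded t c : -1 <= c <= 1 -> exists2 r, 1 < r & t < radial c r.
Proof.
(* Here [r >= 3], so [(r - 1) / (r + 1) >= 1/2]; thus [xtanh r] is at least [1 + |t| / 2] and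
   [xcoth r] at least [2 + |t|], both above [t / 2]. *)
move=> c1; exists (expR (2 + `|t|)).
  by rewrite -[ltLHS]expR0 ltr_expR; have := normr_ge0 t; lra.
set r := expR _.
have tn := ler_norm t; have tp := normr_ge0 t.
have r3 : 3 <= r by have := @expR_ge1Dx R (2 + `|t|); rewrite -/r; lra.
rewrite radialE; last lra.
have -> : t = (1 - c) * (t / 2) + (1 + c) * (t / 2) by field.
have lr : ln r = 2 + `|t| by rewrite /r expRK.
have A : 2 + `|t| <= xcoth r.
  rewrite /xcoth lr ler_peMl ?ler_pdivlMr; lra.
have B : (2 + `|t|) / 2 <= xtanh r.
  rewrite /xtanh lr mulrC ler_pM2r; last lra.
  rewrite ler_pdivlMr; lra.
by apply: wavg_lt => //; lra.
Qed.

(** Intermediate value theorem for the continuous [gap], from 1, where [radial] is [2 - 2 c < t], to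
    a point where [radial] exceeds [t]. *)
Lemma radial_root t c : -1 <= c <= 1 -> 2 - 2 * c < t ->
  exists2 r, 1 < r & radial c r = t.
Proof.
move=> c1 ct; have [s s1 ts] := radial_unbounded t c1.
have [||r] := @IVT _ (gap t c) 1 s 0 (ltW s1).
- by apply: continuous_subspaceT => x; exact: cvg_gap.
- have n1 : gap t c 1 < 0 by rewrite gap_lt0// radial1.
  have n2 : 0 < gap t c s by rewrite gap_gt0//; lra.
  by rewrite ge_min le_max (ltW n1) (ltW n2) orbT.
rewrite in_itv/= => /andP[]; rewrite le_eqVlt => /predU1P[<- _|r1 rs].
  by move=> /eqP; rewrite gap_eq0// radial1; lra.
move=> /eqP; rewrite gap_eq0 => [/eqP rt|]; last lra.
by exists r.
Qed.

End Radial.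

(** * Continuity in the complex plane, polar coordinates and the modulus of [f t] *)

Section ComplexPlane.
Local Open Scope classical_set_scope.
Local Open Scope ring_scope.
Local Open Scope complex_scope.
Variable R : realType.
Implicit Types (z : R[i]) (r t theta : R).

Local Notation Re := (@complex.Re R).
Local Notation Im := (@complex.Im R).

Lemma ReB (z z' : R[i]) : Re (z - z') = Re z - Re z'.
Proof. by case: z z' => [? ?] []. Qed.

Lemma ImB (z z' : R[i]) : Im (z - z') = Im z - Im z'.
Proof. by case: z z' => [? ?] []. Qed.

Lemma normc_ge_Im z : `|Im z|%:C <= `|z|.
Proof.
by rewrite normc_def lecR -sqrtr_sqr ler_wsqrtr// lerDr sqr_ge0.
Qed.

Lemma normc_le_ReIm z : `|z| <= (`|Re z| + `|Im z|)%:C.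
Proof.
rewrite normc_def lecR -[leRHS]ger0_norm ?addr_ge0// -sqrtr_sqr ler_wsqrtr//.
by rewrite sqrrD !real_normK ?num_real// lerD2r lerDl mulrn_wge0.
Qed.

Lemma cvg_Re (z : R[i]^o) : Re x @[x --> z] --> Re z.
Proof.
have FF : Filter (nbhs z) := nbhs_filter z.
apply/cvgrPdist_lt => e e0; near=> x.
rewrite -ReB -ltcR (le_lt_trans (normc_ge_Re (z - x)))//.
by near: x; apply: (@cvgr_dist_lt _ R[i]^o _ _ _ id) => //; rewrite ltcR.
Unshelve. all: by end_near. Qed.

Lemma cvg_Im (z : R[i]^o) : Im x @[x --> z] --> Im z.
Proof.
have FF : Filter (nbhs z) := nbhs_filter z.
apply/cvgrPdist_lt => e e0; near=> x.
rewrite -ImB -ltcR (le_lt_trans (normc_ge_Im (z - x)))//.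
by near: x; apply: (@cvgr_dist_lt _ R[i]^o _ _ _ id) => //; rewrite ltcR.
Unshelve. all: by end_near. Qed.

Lemma cvg_complex (T : Type) (F : set_system T) (FF : Filter F)
    (a b : T -> R) (x y : R) :
  a @ F --> x -> b @ F --> y ->
  (fun s => a s +i* b s : R[i]^o) @ F --> (x +i* y : R[i]^o).
Proof.
move=> ax bY; apply/(@cvgrPdist_lt _ R[i]^o) => -[e e'].
(* A positive element of [R[i]] is real, so the radius reduces to its real part. *)
rewrite ltcE/= => /andP[/eqP -> e0]; near=> s.
rewrite (le_lt_trans (normc_le_ReIm _))// ltcR/= (splitr e) ltrD//.
  by near: s; apply: cvgr_dist_lt => //; rewrite divr_gt0.
by near: s; apply: cvgr_dist_lt => //; rewrite divr_gt0.
Unshelve. all: by end_near. Qed.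

(** This is [|z - 1|^2 - t logmean(|z|^2)], the function [gap] free of angles, hence visibly
    continuous also at the origin. *)
Definition gapz t (z : R[i]^o) : R :=
  (Re z) ^+ 2 + (Im z) ^+ 2 + 1 - 2 * Re z -
  t * logmean ((Re z) ^+ 2 + (Im z) ^+ 2).

Lemma cvg_gapz t (z : R[i]^o) : gapz t x @[x --> z] --> gapz t z.
Proof.
have FF : Filter (nbhs z) := nbhs_filter z.
have sq : (Re x) ^+ 2 + (Im x) ^+ 2 @[x --> z] --> (Re z) ^+ 2 + (Im z) ^+ 2.
  by rewrite !expr2; apply: cvgD; apply: cvgM; (exact: cvg_Re || exact: cvg_Im).
apply: cvgB; last first.
  by apply: cvgM; [exact: cvg_cst|exact: (cvg_comp _ _ sq (@cvg_logmean R _))].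
apply: cvgB; first by apply: cvgD; [exact: sq|exact: cvg_cst].
by apply: cvgM; [exact: cvg_cst|exact: cvg_Re].
Qed.

Lemma polarE r theta : polar r theta = (r * cos theta) +i* (r * sin theta).
Proof. by rewrite /polar; simpc. Qed.

Lemma gapz_polar t r theta : gapz t (polar r theta) = gap t (cos theta) r.
Proof.
rewrite polarE /gapz/= /gap.
have -> : (r * cos theta) ^+ 2 + (r * sin theta) ^+ 2 = r ^+ 2.
  by rewrite !exprMn -mulrDr cos2Dsin2 mulr1.
by rewrite mulrA.
Qed.

Lemma normc_polar r theta : 0 <= r -> `|polar r theta| = r%:C.
Proof.
move=> r0; rewrite polarE normc_def/= !exprMn -mulrDr cos2Dsin2 mulr1.
by rewrite sqrtr_sqr ger0_norm.
Qed.

(** The angle is [acos (x / r)] with the sign of [y]. Its bound by [pi] puts it where the cosine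
    decreases in the absolute value of the angle. *)
Lemma polar_ex z :
  exists2 r, 0 <= r & exists2 theta, `|theta| <= pi & z = polar r theta.
Proof.
case: z => x y; pose r := Num.sqrt (x ^+ 2 + y ^+ 2).
have r2 : r ^+ 2 = x ^+ 2 + y ^+ 2 by rewrite sqr_sqrtr// addr_ge0// sqr_ge0.
have r_ge0 : 0 <= r by apply: sqrtr_ge0.
exists r => //; have [r0|r0] := eqVneq r 0.
  exists 0; first by rewrite normr0 pi_ge0.
  move: r2; rewrite polarE r0 expr0n/= => /esym/eqP.
  by rewrite paddr_eq0 ?sqr_ge0// !sqrf_eq0 => /andP[/eqP -> /eqP ->]; rewrite !mul0r.
have r_gt0 : 0 < r by rewrite lt_neqAle eq_sym r0.
have c1 : -1 <= x / r <= 1.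
  rewrite -ler_norml normrM normfV (ger0_norm r_ge0) ler_pdivrMr// mul1r.
  by rewrite -[leRHS]ger0_norm// -!sqrtr_sqr ler_wsqrtr// r2 lerDl sqr_ge0.
have xE : r * cos (acos (x / r)) = x.
  by rewrite acosK ?in_itv//= mulrC divfK.
have yE : r * sin (acos (x / r)) = `|y|.
  rewrite sin_acos// -{1}[r]ger0_norm// -sqrtr_sqr -sqrtrM ?sqr_ge0//.
  by rewrite mulrBr mulr1 -exprMn [r * _]mulrC divfK// r2 addrC addKr sqrtr_sqr.
have a0 := acos_ge0 c1; have api := acos_lepi c1.
have [y0|y0] := leP 0 y.
  by exists (acos (x / r)); [rewrite ger0_norm|rewrite polarE xE yE ger0_norm].
exists (- acos (x / r)); first by rewrite normrN ger0_norm.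
by rewrite polarE cosN sinN mulrN xE yE ltr0_norm// opprK.
Qed.

Lemma cvg_polar (T : Type) (G : set_system T) (FF : Filter G)
    (a b : T -> R) r theta :
  a @ G --> r -> b @ G --> theta ->
  (fun s => polar (a s) (b s)) @ G --> polar r theta.
Proof.
move=> ar bt; rewrite polarE.
rewrite (_ : (fun s => _) =
    (fun s => (a s * cos (b s)) +i* (a s * sin (b s)) : R[i]^o)).
  apply: cvg_complex.
    by apply: cvgM => //; apply: (cvg_comp _ _ bt); exact: continuous_cos.
  by apply: cvgM => //; apply: (cvg_comp _ _ bt); exact: continuous_sin.
by apply/funext => s; rewrite polarE.
Qed.

Lemma normc_cexp z : `|cexp z| = (expR (Re z))%:C.
Proof. by rewrite -[cexp z]/(polar _ _) normc_polar// expR_ge0. Qed.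

Lemma Re_div (w z : R[i]) :
  Re (w / z) = (Re w * Re z + Im w * Im z) / (Re z ^+ 2 + Im z ^+ 2).
Proof. by case: w z => [a b] [c d] /=; ring. Qed.

Lemma Re_scale r z : Re (r%:C * z) = r * Re z.
Proof. by case: z => x y /=; rewrite mul0r subr0. Qed.

Lemma Re_cayley z : Re ((1 + z) / (1 - z)) =
  (1 - (Re z ^+ 2 + Im z ^+ 2)) / (Re z ^+ 2 + Im z ^+ 2 + 1 - 2 * Re z).
Proof.
rewrite Re_div; case: z => x y /=; congr (_ / _); ring.
Qed.

Lemma f_polar_norm t r theta : 0 <= r -> `|f t (polar r theta)| =
  (r * expR (t / 2 * ((1 - r ^+ 2) / (r ^+ 2 + 1 - 2 * r * cos theta))))%:C.
Proof.
move=> r0; rewrite /f normrM normc_polar// normc_cexp Re_scale Re_cayley.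
have -> : Re (polar r theta) ^+ 2 + Im (polar r theta) ^+ 2 = r ^+ 2.
  by rewrite polarE/= !exprMn -mulrDr cos2Dsin2 mulr1.
by rewrite -rmorphM polarE/= mulrA.
Qed.

(** With [N = |z - 1|^2], the logarithm of [|f_t| = 1] reads [ln r + (t / 2) (1 - r^2) / N = 0],
    which is solved for [t]. The condition [r != 1] stays, since [radial] is also defined on the
    unit circle. *)
Lemma F_polar t r theta : 0 < r ->
  F t (polar r theta) <-> r != 1 /\ radial (cos theta) r = t.
Proof.
move=> r0; set c := cos theta.
rewrite /F/= f_polar_norm 1?ltW// normc_polar 1?ltW// !(inj_eq (@complexI R)).
rewrite -/c.
suff H : r != 1 ->
    r * expR (t / 2 * ((1 - r ^+ 2) / (r ^+ 2 + 1 - 2 * r * c))) = 1 <->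
    radial c r = t.
  split=> -[r1 E]; split=> //; first by apply/(H r1); apply: complexI.
  by congr (_%:C); apply/(H r1).
move=> r1.
have N0 : 0 < r ^+ 2 + 1 - 2 * r * c.
  have : 0 < (r - 1) ^+ 2 by rewrite exprn_even_gt0//= subr_eq0.
  have := cos_le1 theta; rewrite -/c; nra.
have r21 : r ^+ 2 - 1 != 0.
  rewrite subr_eq0 sqrf_eq1 (negbTE r1)/=; lra.
have -> : radial c r = (r ^+ 2 + 1 - 2 * r * c) * (2 * ln r) / (r ^+ 2 - 1).
  rewrite /radial /logmean -subr_eq0 (negbTE r21) ln_sqr//; field.
  by rewrite r21 ln_eq0 ?r1.
move: (r ^+ 2 + 1 - 2 * r * c) N0 => N N0.
have lE : (r * expR (t / 2 * ((1 - r ^+ 2) / N)) = 1) <->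
    ln r + t / 2 * ((1 - r ^+ 2) / N) = 0.
  rewrite -{1}[r]lnK ?posrE// -expRD -expR0; split=> [/expR_inj|->] //.
rewrite lE; split=> [/eqP|<-].
  rewrite addr_eq0 => /eqP ->; field; rewrite r21 lt0r_neq0//.
by field; rewrite r21 lt0r_neq0.
Qed.

Lemma F_neq0 t : ~ F t 0.
Proof.
by case=> _; rewrite /f mul0r normr0 => /esym/eqP; rewrite oner_eq0.
Qed.

End ComplexPlane.

(** * Identification of [E t], [Sigma t] and [r_ t] *)

Section Region.
Local Open Scope classical_set_scope.
Local Open Scope ring_scope.
Local Open Scope complex_scope.
Variable R : realType.
Implicit Types (z : R[i]^o) (c r t u v theta : R).

Lemma cos_itv theta : -1 <= cos theta <= 1.
Proof. by rewrite cos_geN1 cos_le1. Qed.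

(** By [radialV], [radial c (expR u)] is even in [u]. *)
Lemma radial_expR_le c u v : -1 <= c <= 1 -> `|u| <= `|v| ->
  radial c (expR u) <= radial c (expR v).
Proof.
move=> c1 uv.
have E x : radial c (expR x) = radial c (expR `|x|).
  by case: (ger0P x) => // _; rewrite expRN radialV// expR_gt0.
by rewrite E (E v) radial_le// ?ler_expR// -[leLHS]expR0 ler_expR.
Qed.

Lemma radial_cos_le r c c' : 0 < r -> c <= c' -> radial c' r <= radial c r.
Proof.
by move=> r0; rewrite le_eqVlt => /predU1P[->//|cc]; rewrite ltW// radial_cos_lt.
Qed.

Lemma cos_le_norm u v : `|u| <= `|v| -> `|v| <= pi -> cos v <= cos u.
Proof.
rewrite -[cos v]cos_norm -[cos u]cos_norm => uv vpi.
move: uv; rewrite le_eqVlt => /predU1P[->//|uv].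
rewrite ltW// ltr_cos// in_itv/= normr_ge0//=.
exact: le_trans (ltW uv) vpi.
Qed.

Lemma F_gapz t z : F t z -> gapz t z = 0.
Proof.
have [r r0 [theta _ ->]] := polar_ex z; move: r0.
rewrite le_eqVlt => /predU1P[<-|r0].
  by rewrite {1}/polar mul0r => /F_neq0.
by move=> /(F_polar _ _ r0)[_ E]; apply/eqP; rewrite gapz_polar gap_eq0// E.
Qed.

(** The zero set of [gapz] is closed and contains [F t]. *)
Lemma E_gapz t z : E t z -> gapz t z = 0.
Proof.
move=> Ez; apply: contrapT => /eqP g0.
have : nbhs z (fun x => gapz t x != 0).
  apply: (@cvg_gapz R t z (fun y => y != 0)).
  by apply: open_nbhs_nbhs; split; [exact: open_neq|].
move=> /Ez[x [/F_gapz xF]] /=.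
by rewrite xF eqxx.
Qed.

Lemma nbhs_polar r theta (B : set R[i]^o) : nbhs (polar r theta) B ->
  exists2 Q : set R * set R, nbhs r Q.1 /\ nbhs theta Q.2 &
    forall u v, Q.1 u -> Q.2 v -> B (polar u v).
Proof.
move=> BP.
have := @cvg_polar R _ (filter_prod (nbhs r) (nbhs theta)) _ fst snd r theta
  cvg_fst cvg_snd B BP.
by move=> [Q Qn QB]; exists Q => // u v Qu Qv; apply: (QB (u, v)).
Qed.

(** Off the unit circle a zero lies in [F t]. A zero on the circle has [2 - 2 cos theta = t] and is
    a limit of points of [F t]: turning the angle slightly towards 0 raises the cosine, which
    creates a root [rho > 1] of [radial = t] close to 1. *)
Lemma gapz_E t z : 0 < t -> gapz t z = 0 -> E t z.
Proof.
move=> t0; have [r r0 [theta tpi ->]] := polar_ex z.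
rewrite gapz_polar; move: r0; rewrite le_eqVlt => /predU1P[<-|r0].
  by rewrite gap0 => /eqP; rewrite oner_eq0.
move=> /eqP; rewrite gap_eq0// => /eqP rt.
have [r1|r1] := eqVneq r 1; last first.
  by apply: subset_closure; apply/F_polar.
move: rt; rewrite r1 radial1 => ct {r r0 r1}.
move=> B /nbhs_polar[[Q1 Q2] /= [Q1n Q2n] QB].
have [e e0 Q1e] : exists2 e : R, 0 < e & forall x, `|1 - x| < e -> Q1 x.
  by move/nbhs_ballP : Q1n => [e /= e0 He]; exists e => // x ?; apply: He.
have the0 : 0 < `|theta|.
  by rewrite normr_gt0; apply/eqP => th0; move: ct; rewrite th0 cos0; lra.
have tcvg : (1 - s) * theta @[s --> 0^'+] --> theta.
  suff : (1 - s) * theta @[s --> 0^'+] --> (1 - 0) * theta by rewrite subr0 mul1r.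
  apply: cvg_at_right_filter; apply: cvgM; last exact: cvg_cst.
  by apply: cvgB; [exact: cvg_cst|exact: cvg_id].
(* Positivity of [gap] at radius [1 + e / 2] persists for nearby angles and forces
   [rho < 1 + e / 2]. *)
have gcvg : gap t (cos ((1 - s) * theta)) (1 + e / 2) @[s --> 0^'+] -->
    gap t (cos theta) (1 + e / 2).
  rewrite /gap; apply: cvgB; last exact: cvg_cst.
  apply: cvgB; first exact: cvg_cst.
  apply: cvgM; first exact: cvg_cst.
  by apply: (cvg_comp _ _ tcvg); exact: continuous_cos.
have g0 : 0 < gap t (cos theta) (1 + e / 2).
  rewrite gap_gt0; last lra.
  by rewrite -ct -radial1 radial_lt ?cos_itv//; lra.
near (0 : R)^'+ => s.
have s0 : 0 < s by near: s; exact: nbhs_right_gt.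
have s1 : s < 1 by near: s; exact: nbhs_right_lt.
have Q2s : Q2 ((1 - s) * theta) by near: s; exact: tcvg.
have gs : 0 < gap t (cos ((1 - s) * theta)) (1 + e / 2).
  by near: s; apply: (cvgr_gt _ gcvg).
have cs : cos theta < cos ((1 - s) * theta).
  have lt : `|(1 - s) * theta| < `|theta|.
    by rewrite normrM gtr0_norm ?subr_gt0// gtr_pMl//; lra.
  rewrite -[cos theta]cos_norm -[cos (_ * _)]cos_norm ltr_cos// in_itv/= normr_ge0//=.
  exact: le_trans (ltW lt) tpi.
have [|rho rho1 rhot] := @radial_root R t _ (cos_itv ((1 - s) * theta)); first lra.
exists (polar rho ((1 - s) * theta)); split.
  by apply/F_polar; [lra|split=> //; rewrite gt_eqF].
apply: QB => //; apply: Q1e.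
have [rhoe|rhoe] := ltP rho (1 + e / 2); first by rewrite ltr0_norm; lra.
exfalso.
have : t < radial (cos ((1 - s) * theta)) (1 + e / 2) by rewrite -gap_gt0//; lra.
have : radial (cos ((1 - s) * theta)) (1 + e / 2) <= radial (cos ((1 - s) * theta)) rho.
  by apply: radial_le; rewrite ?cos_itv//; lra.
by rewrite rhot; lra.
Unshelve. all: by end_near. Qed.

Lemma gapz1 t : gapz t 1 = - t.
Proof. by rewrite /gapz/= !expr1n expr0n/= addr0 logmean1; ring. Qed.

(** On the connected set [Sigma t], [gapz] has no zero, and it is [- t] at 1, so it stays negative.
    Conversely, a path inside [gapz < 0] joins 1 to any point where [gapz] is negative. *)
Lemma Sigma_gapz t z : 0 < t -> Sigma t z <-> gapz t z < 0.
Proof.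
move=> t0; split=> [Sz|].
  have cS : connected (Sigma t) by exact: component_connected.
  have E1 : (~` E t) (1 : R[i]^o) by move=> /E_gapz; rewrite gapz1; lra.
  have S1 : Sigma t 1 by exact: connected_component_refl.
  have SE : Sigma t `<=` ~` E t by exact: connected_component_sub.
  have /connected_intervalP itv : connected (gapz t @` Sigma t).
    apply: connected_continuous_connected => //.
    by apply: continuous_subspaceT => x; exact: cvg_gapz.
  rewrite ltNge; apply/negP => g0.
  have [z' Sz' z'0] : (gapz t @` Sigma t) 0.
    apply: (itv (gapz t 1) (gapz t z)); [by exists 1|by exists z|].
    by rewrite gapz1 g0 andbT; lra.
  by apply: (SE _ Sz'); apply: gapz_E.
have [r r0 [theta tpi ->]] := polar_ex z; move: r0.
rewrite gapz_polar le_eqVlt => /predU1P[<-|r0]; first by rewrite gap0 ltr10.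
rewrite gap_lt0// => rt.
(* A logarithmic spiral: for [s] in [[0, 1]], neither the absolute value of the log-modulus nor that
   of the angle exceeds its value at the endpoint, so neither does [radial]. *)
pose path s : R[i]^o := polar (expR (s * ln r)) (s * theta).
have path1 : path 1 = polar r theta by rewrite /path !mul1r lnK.
have path0 : path 0 = 1.
  by rewrite /path !mul0r expR0 polarE cos0 sin0 mulr1 mulr0.
rewrite -path1; apply: (@connected_component_max _ _ (path @` `[0, 1])).
- by exists 0 => //=; rewrite in_itv/= lexx ler01.
- move=> _ [s /= + <-] => /[!in_itv]/= /andP[s0 s1] /E_gapz /eqP.
  apply/negP; rewrite gapz_polar lt_eqF// gap_lt0 ?expR_gt0//.
  apply: le_lt_trans rt; rewrite -{2}(lnK r0).
  apply: (@le_trans _ _ (radial (cos (s * theta)) (expR (ln r)))).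
    by rewrite radial_expR_le ?cos_itv// normrM ger0_norm// ler_piMl.
  apply: radial_cos_le; first exact: expR_gt0.
  by apply: cos_le_norm => //; rewrite normrM ger0_norm// ler_piMl.
- apply: connected_continuous_connected; first exact: segment_connected.
  apply: continuous_subspaceT => s; apply: cvg_polar.
    apply: (@cvg_comp _ _ _ (fun s => s * ln r) expR _ (nbhs (s * ln r)));
      last exact: continuous_expR.
    by apply: cvgM; [exact: cvg_id|exact: cvg_cst].
  by apply: cvgM; [exact: cvg_id|exact: cvg_cst].
- by exists 1 => //=; rewrite in_itv/= lexx ler01.
Qed.

Lemma frontier_gapz t z : 0 < t -> frontier (Sigma t) z -> gapz t z = 0.
Proof.
move=> t0 [cz iz]; apply/eqP; rewrite eq_le !leNgt; apply/andP; split; apply/negP => g0.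
  have : nbhs z (fun x => 0 < gapz t x).
    by apply: (@cvg_gapz R t z (fun y => 0 < y)); exact: lt_nbhsr.
  move=> /cz[x [/(Sigma_gapz _ t0) xS]] /=.
  by rewrite ltNge (ltW xS).
apply: iz; have : nbhs z (fun x => gapz t x < 0).
  by apply: (@cvg_gapz R t z (fun y => y < 0)); exact: lt_nbhsl.
by apply: filterS => x /Sigma_gapz; exact.
Qed.

(** Slightly smaller radii lie in [Sigma t], so [r] is a frontier radius; beyond [r], [radial]
    exceeds [t], so [r] is the largest one. *)
Lemma r_root t theta r : 0 < t -> 1 < r -> radial (cos theta) r = t ->
  r_ t theta = r.
Proof.
move=> t0 r1 rt; have r0 : 0 < r by lra.
set A := [set x : R | 0 <= x /\ frontier (Sigma t) (polar x theta)].
have Ar : A r.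
  split; first exact: ltW.
  split; last first.
    move=> /interior_subset /(Sigma_gapz _ t0).
    by rewrite gapz_polar gap_lt0// rt ltxx.
  move=> B /nbhs_polar[[Q1 Q2] /= [Q1n Q2n] QB].
  near r^'- => x.
  have x1 : 1 < x by near: x; exact: nbhs_left_gt.
  have xr : x < r by near: x; exact: nbhs_left_lt.
  exists (polar x theta); split.
    apply/(Sigma_gapz _ t0); rewrite gapz_polar gap_lt0; last lra.
    by rewrite -rt radial_lt ?cos_itv// ltW.
  apply: QB; last exact: nbhs_singleton.
  by near: x; exact: cvg_within Q1n.
have ubA : ubound A r.
  move=> x [x0 /frontier_gapz]; rewrite gapz_polar => /(_ t0)/eqP.
  move: x0; rewrite [0 <= x]le_eqVlt => /predU1P[<- _|x0]; first exact: ltW.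
  rewrite gap_eq0// => /eqP xt; rewrite leNgt; apply/negP => rx.
  by have := @radial_lt R (cos theta) r x (cos_itv _) (ltW r1) rx; rewrite rt xt ltxx.
apply/eqP; rewrite eq_le /r_ -/A; apply/andP; split.
  by apply: ge_sup => //; exists r.
by apply: ub_le_sup => //; exists r.
Unshelve. all: by end_near. Qed.

(** On the ray, [radial] is least at radius 1, with value [2 - 2 cos theta]. *)
Lemma ray_meets_SigmaE t theta : 0 < t ->
  ray_meets_Sigma t theta -> 2 - 2 * cos theta < t.
Proof.
move=> t0 [r r0 /(Sigma_gapz _ t0)]; rewrite gapz_polar.
move: r0; rewrite le_eqVlt => /predU1P[<-|r0]; first by rewrite gap0 ltr10.
rewrite gap_lt0//; apply: le_lt_trans.
rewrite -radial1 -expR0 -[X in _ <= radial _ X](lnK r0).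
by rewrite radial_expR_le ?cos_itv// normr0.
Qed.

End Region.

(** * Differentiation of [h], [r_ t] and [w_arg t] *)

Section Derivative.
Local Open Scope classical_set_scope.
Local Open Scope ring_scope.
Variable R : realType.
Implicit Types (c r t theta : R).

(** Carathéodory slopes [phi] of [H] at [g x] and [psi] of [k] at [x] satisfy
    [phi (g y) (g y - g x) = psi y (y - x)] near [x]. Continuity of [g] gives [phi (g y) --> dH],
    which is nonzero, so the quotient [psi y / phi (g y)] is the slope of [g]. *)
Lemma is_derive_implicit (g H k : R -> R) (x dH dk : R) :
  g @ x --> g x -> is_derive (g x) 1 H dH -> dH != 0 ->
  is_derive x 1 k dk -> (\forall y \near x, H (g y) = k y) ->
  is_derive x 1 g (dk / dH).
Proof.
move=> gx /is_derive1_caratheodory[phi [phiE phiC phix]] dH0.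
move=> /is_derive1_caratheodory[psi [psiE psiC psix]] Hg.
have pg : phi (g y) @[y --> x] --> dH.
  by rewrite -phix; apply: (cvg_comp _ _ gx); exact: phiC.
apply/is_derive1_caratheodory.
exists (fun y => if y == x then dk / dH else (g y - g x) / (y - x)).
split; [|rewrite /prop_for/continuous_at eqxx|by rewrite eqxx].
  move=> z; case: eqVneq => [->|zx]; first by rewrite !subrr mulr0.
  by rewrite divfK// subr_eq0.
have E : {near x, (fun y => psi y / phi (g y)) =1
    (fun y => if y == x then dk / dH else (g y - g x) / (y - x))}.
  near=> y; case: eqVneq => [->|yx]; first by rewrite phix psix.
  have phi0 : phi (g y) != 0.
    near: y; apply: (pg (fun u => u != 0)).
    by apply: open_nbhs_nbhs; split; [exact: open_neq|].
  have Hgy : H (g y) = k y by near: y.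
  have Hgx : H (g x) = k x by exact: (nbhs_singleton Hg).
  have yx0 : y - x != 0 by rewrite subr_eq0.
  have : phi (g y) * (g y - g x) = psi y * (y - x).
    by rewrite -phiE -psiE Hgy Hgx.
  move=> eq; apply: (mulIf yx0); rewrite divfK//.
  by apply: (mulfI phi0); rewrite eq; field.
apply: cvg_trans (near_eq_cvg E) _.
apply: cvgM; first by rewrite -psix; exact: psiC.
exact: cvgV.
Unshelve. all: by end_near. Qed.

Lemma r_spec t theta : 0 < t -> 2 - 2 * cos theta < t ->
  1 < r_ t theta /\ radial (cos theta) (r_ t theta) = t.
Proof.
move=> t0 ct; have [r r1 rt] := radial_root (cos_itv theta) ct.
by rewrite (r_root t0 r1 rt).
Qed.

Lemma near_cos_lt t theta : 2 - 2 * cos theta < t ->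
  \forall x \near theta, 2 - 2 * cos x < t.
Proof.
have : 2 - 2 * cos x @[x --> theta] --> 2 - 2 * cos theta.
  apply: cvgB; first exact: cvg_cst.
  by apply: cvgM; [exact: cvg_cst|exact: continuous_cos].
by move=> /cvgr_lt; exact.
Qed.

Lemma cvg_gap_cos t r theta :
  gap t (cos x) r @[x --> theta] --> gap t (cos theta) r.
Proof.
apply: cvgB; last exact: cvg_cst.
apply: cvgB; first exact: cvg_cst.
by apply: cvgM; [exact: cvg_cst|exact: continuous_cos].
Qed.

(** The signs of [gap] at two radii around [r] persist for nearby angles, and monotonicity traps the
    root between them. *)
Lemma cvg_r_ t theta : 0 < t -> 2 - 2 * cos theta < t ->
  r_ t x @[x --> theta] --> r_ t theta.
Proof.
move=> t0 ct; have [r1 rt] := r_spec t0 ct.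
move: (r_ t theta) r1 rt => r r1 rt.
apply/cvgrPdist_lt => e e0.
(* The lower radius must stay above 1, where [radial] increases. *)
have [a a1 [ar are]] : exists2 a : R, 1 < a & a < r /\ r - a < e.
  have [re|re] := ltP (r - 1) e; first by exists ((1 + r) / 2); [|split]; lra.
  by exists (r - e / 2); [|split]; lra.
have ga : gap t (cos theta) a < 0.
  by rewrite gap_lt0 -?rt ?radial_lt ?cos_itv//; lra.
have gb : 0 < gap t (cos theta) (r + e / 2).
  by rewrite gap_gt0 -?[ltLHS]rt ?radial_lt ?cos_itv//; lra.
near=> x.
have cx : 2 - 2 * cos x < t by near: x; exact: near_cos_lt.
have [s1 st] := r_spec t0 cx.
have gax : gap t (cos x) a < 0 by near: x; apply: (cvgr_lt _ (@cvg_gap_cos t a theta)).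
have gbx : 0 < gap t (cos x) (r + e / 2).
  by near: x; apply: (cvgr_gt _ (@cvg_gap_cos t (r + e / 2) theta)).
move: (r_ t x) s1 st => s s1 st.
have ras : a < s.
  rewrite ltNge; apply/negP => sa; have := radial_le (cos_itv x) (ltW s1) sa.
  have a0 : 0 < a by lra.
  by rewrite st leNgt -gap_lt0// gax.
have rbs : s < r + e / 2.
  rewrite ltNge; apply/negP => sb.
  have b1 : 1 <= r + e / 2 by lra.
  have := radial_le (cos_itv x) b1 sb.
  have b0 : 0 < r + e / 2 by lra.
  by rewrite st leNgt -gap_gt0// gbx.
rewrite ltr_distl; lra.
Unshelve. all: by end_near. Qed.

Lemma h_gt0 r : 1 < r -> 0 < h r.
Proof.
move=> r1; rewrite /h ln_sqr; last lra.
have l0 := ln_gt0 r1.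
by rewrite mulr_gt0 ?divr_gt0//; nra.
Qed.

(** With [L = ln r], [h r] is [L / sinh L]. *)
Lemma h_lt1 r : 1 < r -> h r < 1.
Proof.
move=> r1; have r0 : 0 < r by lra.
have L := ln_lt_sinh r1.
rewrite /h ln_sqr// mulrA ltr_pdivrMr ?mul1r; last nra.
have -> : r ^+ 2 - 1 = r * (r - r^-1) by field; apply: lt0r_neq0.
by rewrite ltr_pM2l.
Qed.

(** The expression is affine in [c], with values [(r - 1)^2 (1 + h)] at 1 and [(r + 1)^2 (1 - h)] at
    -1, both positive as [0 < h < 1]. *)
Lemma denom_gt0 c r : 1 < r -> -1 <= c <= 1 -> 0 < beta r * c + alpha r.
Proof.
move=> r1 c1; have h0 := h_gt0 r1; have h1 := h_lt1 r1.
have -> : beta r * c + alpha r =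
    (1 - c) * ((r + 1) ^+ 2 * (1 - h r) / 2) + (1 + c) * ((r - 1) ^+ 2 * (1 + h r) / 2).
  by rewrite /alpha /beta; field.
rewrite -[ltLHS](_ : (1 - c) * 0 + (1 + c) * 0 = 0); last by rewrite !mulr0 addr0.
by apply: wavg_lt; rewrite // divr_gt0// mulr_gt0 ?exprn_gt0//; lra.
Qed.

Lemma radial_h c r : 1 < r -> radial c r = (r + r^-1 - 2 * c) * h r.
Proof.
move=> r1; have r0 : 0 < r by lra.
have r21 : r ^+ 2 - 1 != 0 by apply: lt0r_neq0; nra.
rewrite /radial /logmean -subr_eq0 (negbTE r21) /h; field.
by rewrite r21 lt0r_neq0//= ln_eq0 ?exprn_gt0// -subr_eq0.
Qed.

Lemma is_derive_h r : 1 < r ->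
  is_derive r 1 (@h R) (- beta r / (r * (r ^+ 2 - 1))).
Proof.
move=> r1; have r0 : 0 < r by lra.
have r21 : r ^+ 2 - 1 != 0 by apply: lt0r_neq0; nra.
have E : \forall x \near r, 2 * x * ln x * (x ^+ 2 - 1)^-1 = h x.
  near=> x; have x0 : 0 < x by near: x; exact: lt_nbhsr.
  by rewrite /h ln_sqr//; ring.
apply: near_eq_is_derive E _.
have H := is_derive1_ln r0.
apply: is_derive_eq.
rewrite /GRing.scale/= /beta /h ln_sqr//; field.
by rewrite r21 lt0r_neq0.
Unshelve. all: by end_near. Qed.

Lemma is_derive_cos_of_r t c r : 1 < r -> radial c r = t ->
  is_derive r 1 (fun x : R => (x + x^-1) / 2 - t / 2 * (h x)^-1)
    ((beta r * c + alpha r) / (r * h r * (r ^+ 2 - 1))).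
Proof.
move=> r1 rt; have r0 : 0 < r by lra.
have r00 : r != 0 by exact: lt0r_neq0.
have r21 : r ^+ 2 - 1 != 0 by apply: lt0r_neq0; nra.
have h0 : h r != 0 by apply: lt0r_neq0; exact: h_gt0.
have Hh := is_derive_h r1.
have HV := is_derive_inv r00.
apply: is_derive_eq.
(* The constant [t] is expressed through [c] and [r] only after differentiating. *)
rewrite /GRing.scale/= -rt radial_h// /alpha /beta; field.
by rewrite h0 r21 r00.
Qed.

Lemma is_derive_r_ t theta : 0 < t -> 2 - 2 * cos theta < t ->
  let r := r_ t theta in
  is_derive theta 1 (r_ t)
    (- sin theta * (r * h r * (r ^+ 2 - 1)) / (beta r * cos theta + alpha r)).
Proof.
move=> t0 ct r; have [r1 rt] := r_spec t0 ct.
rewrite -/r in r1 rt *.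
have D0 := denom_gt0 r1 (cos_itv theta).
have h0 := h_gt0 r1.
have r0 : 0 < r by apply: lt_trans r1.
have r20 : 0 < r ^+ 2 - 1 by rewrite subr_gt0 expr_gt1 ?ltW.
have N0 : 0 < r * h r * (r ^+ 2 - 1) by rewrite mulr_gt0// mulr_gt0.
(* This exposes the form [dk / dH] with [k = cos]. *)
rewrite -mulrA -invf_div.
apply: (is_derive_implicit (cvg_r_ t0 ct) (is_derive_cos_of_r r1 rt)).
  by rewrite lt0r_neq0// divr_gt0.
near=> x.
have cx : 2 - 2 * cos x < t by near: x; exact: near_cos_lt.
have [s1 st] := r_spec t0 cx.
move: (r_ t x) s1 st => s s1 st.
have hs0 := h_gt0 s1; have s0 : 0 < s by apply: lt_trans s1.
rewrite -st radial_h//; field.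
by rewrite !lt0r_neq0.
Unshelve. all: by end_near. Qed.

(** By [radial_h] the denominator of [w_arg] is [r t / h(r)]. *)
Lemma w_argE t theta : 0 < t -> 2 - 2 * cos theta < t ->
  w_arg t theta = 2 / t * (sin theta * h (r_ t theta)).
Proof.
move=> t0 ct; have [r1] := r_spec t0 ct.
rewrite /w_arg; move: (r_ t theta) r1 => r r1; rewrite radial_h// => rt.
have r0 : 0 < r by lra.
have h0 := h_gt0 r1.
have N0 : r ^+ 2 + 1 - 2 * r * cos theta != 0.
  apply/eqP => N0; move: rt.
  have -> : r + r^-1 - 2 * cos theta = (r ^+ 2 + 1 - 2 * r * cos theta) / r.
    by field; apply: lt0r_neq0.
  by rewrite N0 !mul0r; lra.
rewrite -rt; field.
have -> : r * r + 1 + - (2 * cos theta) * r = r ^+ 2 + 1 - 2 * r * cos theta by ring.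
by rewrite N0 !lt0r_neq0.
Qed.

End Derivative.

(* [derivable] is stated because the derivative occurring in [w] is a total
   function, with no content where the limit does not exist. *)
Theorem proposition2p3 (R : realType) (t : R) (t_gt0 : 0 < t)
    (theta : R) (Htheta : ray_meets_Sigma t theta) :
  derivable (w_arg t) theta 1 /\
  w t theta = (2 * pi * t)^-1 * omega (r_ t theta) theta.
Proof.
have ct := ray_meets_SigmaE t_gt0 Htheta.
have [r1 rt] := r_spec t_gt0 ct.
have Dr := is_derive_r_ t_gt0 ct.
have Dh := is_derive_h r1.
have D0 := denom_gt0 r1 (cos_itv theta).
have h0 := h_gt0 r1; have pi0 := pi_gt0 R.
have r0 : 0 < r_ t theta by apply: lt_trans r1.
have r20 : 0 < r_ t theta ^+ 2 - 1 by rewrite subr_gt0 expr_gt1 ?ltW.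
set r := r_ t theta in r1 rt Dr Dh D0 h0 r0 r20 *.
have Dw : is_derive theta 1 (w_arg t)
    (2 / t * (h r *
     ((alpha r * cos theta + beta r) / (beta r * cos theta + alpha r)))).
  have E : \forall x \near theta, 2 / t * (sin x * h (r_ t x)) = w_arg t x.
    by near=> x; rewrite w_argE//; near: x; exact: near_cos_lt.
  apply: near_eq_is_derive E _.
  have Dhr := is_derive1_comp Dh Dr.
  apply: is_derive_eq.
  rewrite /GRing.scale/=; congr (_ * _); rewrite -/r.
  have -> : sin theta * (- beta r / (r * (r ^+ 2 - 1)) *
      (- sin theta * (r * h r * (r ^+ 2 - 1)) /
       (beta r * cos theta + alpha r))) =
      h r * beta r * sin theta ^+ 2 / (beta r * cos theta + alpha r).
    by field; rewrite !lt0r_neq0.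
  (* Over the common denominator, [beta cos^2 + beta sin^2] collapses to [beta]. *)
  by rewrite sin2cos2; field; rewrite lt0r_neq0.
split; first exact: ex_derive.
rewrite /w derive1E derive_val /omega; move: (pi : R) pi0 => p p0; field.
by rewrite !lt0r_neq0.
Unshelve. all: by end_near. Qed.
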